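(* Let the data domain $\mathcal{U}_p$ be the $d$-dimensional ball of radius $1$ and the query domain $\mathcal{U}_q$ the $d$-dimensional ball of radius $U$ (centered at the origin), and let $0<c<1$, $s>0$. Consider an $(s,cs,P_1,P_2)$-asymmetric LSH for signed IPS (similarity $sim(p,q)=p^Tq$) or, where indicated, for unsigned IPS (similarity $sim(p,q)=|p^Tq|$). Then the following upper bounds on $P_1-P_2$ apply: 1. if $d\ge 1$ and $s\le\min\{cU,\,U/(4\sqrt{d})\}$, then $P_1-P_2=O\big(1/\log(d\log_{1/c}(U/s))\big)$, for both signed and unsigned IPS; 2. if $d\ge 2$ and $s\le U/(2d)$, then $P_1-P_2=O\big(1/\log(dU/(s(1-c)))\big)$, for signed IPS; 3. if $d>\Theta(U^5/(c^2s^5))$ and $s\le U/8$, then $P_1-P_2=O(\sqrt{s/U})$, for both signed and unsigned IPS. It follows that, for any given dimension $d$, there cannot exist an asymmetric LSH (with $P_1>P_2$) when the query domain is unbounded.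
   Context: Asymmetric LSH: let $\mathcal{U}_p$ be the data domain and $\mathcal{U}_q$ the query domain, and let $\mathcal{H}$ be a (distribution over a) family of pairs of hash functions $h=(h_p(\cdot),h_q(\cdot))$. $\mathcal{H}$ is an $(s,cs,P_1,P_2)$-asymmetric LSH for a similarity function $sim$ if for all $p\in\mathcal{U}_p$, $q\in\mathcal{U}_q$: (i) if $sim(p,q)\ge s$ then $\Pr_{\mathcal{H}}[h_p(p)=h_q(q)]\ge P_1$; (ii) if $sim(p,q)<cs$ then $\Pr_{\mathcal{H}}[h_p(p)=h_q(q)]\le P_2$. Signed IPS uses $sim(p,q)=p^Tq$; unsigned IPS uses $sim(p,q)=|p^Tq|$. *)

(* Defs.v *)
From HB Require Import structures.
From mathcomp Require Import all_boot all_order all_algebra.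
From mathcomp Require Import all_classical all_reals all_analysis.
Set Implicit Arguments. Unset Strict Implicit. Unset Printing Implicit Defensive.
Import Order.TTheory GRing.Theory Num.Theory.
Local Open Scope classical_set_scope.
Local Open Scope ring_scope.

Definition ips_dot {R : realType} {n : nat} (p q : 'rV[R]_n) : R :=
  \sum_(i < n) p ord0 i * q ord0 i.

Definition origin_ball {R : realType} (n : nat) (r : R) : set 'rV[R]_n :=
  [set p | ips_dot p p <= r ^+ 2].

Definition ips_sim {R : realType} {n : nat} (unsigned : bool) (p q : 'rV[R]_n) : R :=
  if unsigned then `|ips_dot p q| else ips_dot p q.

Definition hash_collision {R : realType} {n : nat} (T Y : Type)
  (hp hq : T -> 'rV[R]_n -> Y) (p q : 'rV[R]_n) : set T :=
  [set w | hp w p = hq w q].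

(* The distribution P over pairs (hp w, hq w) is an (s, cs, P1, P2)-asymmetric LSH
   for similarity sim, data domain Dp and query domain Dq.  Collision events are
   required to be measurable so that their probabilities are defined. *)
Definition is_ALSH {R : realType} {n : nat} {dsp : measure_display}
  (T : measurableType dsp) (P : probability T R) (Y : Type)
  (hp hq : T -> 'rV[R]_n -> Y) (sim : 'rV[R]_n -> 'rV[R]_n -> R)
  (Dp Dq : set 'rV[R]_n) (s cs P1 P2 : R) : Prop :=
  forall p q, Dp p -> Dq q ->
    [/\ measurable (hash_collision hp hq p q),
        (s <= sim p q -> (P1%:E <= P (hash_collision hp hq p q))%E) &
        (sim p q < cs -> (P (hash_collision hp hq p q) <= P2%:E)%E)].

Arguments origin_ball {R} n r _.

(* Main.v *)
Require Import Defs.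
From HB Require Import structures.
From mathcomp Require Import all_boot all_order all_algebra finfield.
From mathcomp Require Import all_classical all_reals all_analysis.
From mathcomp Require Import zify ring lra.
Set Implicit Arguments. Unset Strict Implicit. Unset Printing Implicit Defensive.
Import Order.TTheory GRing.Theory Num.Theory.

(* Call p_0, ..., p_{n-1} and q_0, ..., q_{n-1} a staircase if sim(p_i, q_j) >= s
   for i <= j and sim(p_i, q_j) < cs for i > j.  Weight the collision of p_i and
   q_j by the Hilbert matrix 1/(2(j - i) + 1).  For a fixed pair of hash functions
   the colliding index pairs form disjoint rectangles, and since the rows of the
   Hilbert matrix are almost orthogonal the weighted number of collisions is at
   most 2n.  The positive and the negative weights both add up to about
   (n ln n)/2, so taking expectations gives P1 - P2 = O(1/ln n).
   It remains to find long staircases: unit vectors against partial sums (n = d);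
   geometric progressions on a line (n about log_{1/c}(U/s)); plane vectors with
   products s(1 + 2(1 - c)(j - i)) (n about sqrt(U/(s(1 - c)))); and, in high
   dimension, sums of almost orthogonal Reed-Solomon vectors indexed by the nodes
   of a binary tree (n about 2^sqrt(U/s)). *)

(** * Almost orthogonal vectors *)

(* [z v] is the indicator of the graph over GF(2^e) of the [v]-th polynomial of
   degree less than [D]. *)
Lemma reed_solomon (e D N : nat) : (0 < e)%N -> (N <= 2 ^ D)%N ->
  exists (J : finType) (z : nat -> J -> bool),
  [/\ #|J| = (2 ^ e * 2 ^ e)%N, forall v, (\sum_j z v j)%N = (2 ^ e)%N &
      forall v w, (v < N)%N -> (w < N)%N -> v != w ->
      (\sum_j z v j * z w j <= D)%N].
Proof.
move=> e0 ND; have [F _ cF] := @pPrimePowerField 2 e isT e0.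
pose f v : {poly F} := rVpoly (nth 0%R (enum 'rV[F]_D) v).
exists (F * F)%type, (fun v ty => (f v).[ty.1]%R == ty.2).
split=> [|v|v w vN wN vw]; first by rewrite card_prod cF.
  rewrite -(pair_bigA_idem _ (fun t y => nat_of_bool ((f v).[t]%R == y))) //=.
  rewrite -cF -sum1_card; apply: eq_bigr => t _.
  rewrite (bigD1 (f v).[t]%R)//= eqxx big1// => y.
  by rewrite eq_sym => /negPf->.
(* Past the end of the enumeration [nth] would return the zero polynomial for every index. *)
have size_enum u : (u < N)%N -> (u < size (enum 'rV[F]_D))%N.
  move=> uN; rewrite -cardE card_mx mul1n cF (leq_trans uN)// (leq_trans ND)//.
  by rewrite -expnM leq_exp2l// leq_pmull.
have fvw : (f v - f w != 0)%R.
  rewrite subr_eq0; apply: contra vw => /eqP /(can_inj rVpolyK)/eqP.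
  by rewrite nth_uniq ?enum_uniq ?size_enum.
rewrite -(pair_bigA_idem _ (fun t y => ((f v).[t]%R == y) * ((f w).[t]%R == y))%N) //=.
(* Two graphs meet above the roots of [f v - f w], a nonzero polynomial of degree less than [D]. *)
have -> : (\sum_t \sum_y ((f v).[t]%R == y) * ((f w).[t]%R == y) =
    #|[pred t | root (f v - f w) t]|)%N.
  rewrite -sum1_card [RHS]big_mkcond /=; apply: eq_bigr => t _.
  rewrite (bigD1 (f v).[t]%R)//= eqxx big1 ?addn0 => [|y].
    rewrite inE /root hornerD hornerN subr_eq0 eq_sym mul1n.
    by case: eqP.
  by rewrite eq_sym => /negPf->.
rewrite cardE ltnW// (leq_trans (max_poly_roots fvw _ (enum_uniq _)))//.
  by apply/allP => t; rewrite mem_enum inE.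
by rewrite (leq_trans (size_polyD _ _))// size_polyN geq_max !size_poly.
Qed.

(** Halve both leaves until they are siblings, the left one even; [k] counts the halvings. *)
Lemma binary_branching (m i j : nat) : (i < j)%N -> (j < 2 ^ m)%N ->
  exists k, [/\ (k < m)%N, ~~ odd (i %/ 2 ^ k) & (j %/ 2 ^ k)%N = (i %/ 2 ^ k).+1].
Proof.
elim: m i j => [|m IH] i j ij jm; first by case: j ij jm => [|[]].
have [ij2|ij2] := ltnP (i %/ 2) (j %/ 2).
  have [|k [km ik jk]] := IH _ _ ij2; first by rewrite ltn_divLR// -expnSr.
  by exists k.+1; rewrite expnS !divnMA.
by exists 0%N; rewrite expn0 !divn1; split; lia.
Qed.

(* The node at height [k] above the leaf [u] of a binary tree is [u %/ 2 ^ k].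
   [X i] sums the codewords of the right siblings of the left children above [i],
   and [Y j] those of the right children above [j]; the two share a node exactly
   when [i < j], where the two branches split. *)
Lemma comparison_vectors (e m : nat) : (0 < e)%N -> (0 < m)%N ->
  exists (J : finType) (X Y : nat -> J -> nat),
  [/\ #|J| = (2 ^ e * 2 ^ e)%N,
      forall i, (\sum_t X i t * X i t <= m * m * 2 ^ e)%N,
      forall j, (\sum_t Y j t * Y j t <= m * m * 2 ^ e)%N,
      forall i j, (i < j)%N -> (j < 2 ^ m)%N -> (2 ^ e <= \sum_t X i t * Y j t)%N &
      forall i j, (j <= i)%N -> (i < 2 ^ m)%N ->
        (\sum_t X i t * Y j t <= m * m * (3 * m))%N].
Proof.
move=> e0 m0.
(* [code] numbers the pairs of a height below [m] and a node at most [2 ^ m], which allows for right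
   siblings. *)
pose N := (m * (2 ^ m).+1)%N.
have ND : (N <= 2 ^ (3 * m))%N.
  have -> : (3 * m = m + (m + m))%N by lia.
  rewrite expnD leq_mul//; first by rewrite ltnW// ltn_expl.
  by rewrite expnD -{1}[(2 ^ m)%N]muln1 ltn_pmul2l ?expn_gt0// (ltn_exp2l 0).
have [J [z [cJ zq zD]]] := reed_solomon e0 ND.
pose code k v := (v * m + k)%N.
pose S (Q : pred nat) (u : nat -> nat) t := (\sum_(k < m | Q k) z (code k (u k)) t)%N.
pose G v w := (\sum_t z v t * z w t)%N.
have G_le v w : (G v w <= 2 ^ e)%N.
  by rewrite -(zq v) leq_sum// => t _; case: (z v t); case: (z w t).
have dotS Q u Q' u' : (\sum_t S Q u t * S Q' u' t =
    \sum_(k < m | Q k) \sum_(l < m | Q' l) G (code k (u k)) (code l (u' l)))%N.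
  under eq_bigr do rewrite big_distrl /=.
  rewrite exchange_big; apply: eq_bigr => k _.
  under eq_bigr do rewrite big_distrr /=.
  by rewrite exchange_big.
have dot_le (Q Q' : pred nat) (u u' : nat -> nat) b :
    (forall k l : 'I_m, Q k -> Q' l ->
      G (code k (u k)) (code l (u' l)) <= b)%N ->
    (\sum_t S Q u t * S Q' u' t <= m * m * b)%N.
  move=> Gb; rewrite dotS -mulnA -[X in (X * _)%N]card_ord -sum_nat_const.
  rewrite big_mkcond leq_sum// => k _; case: ifP => // Qk.
  rewrite -[X in (X * _)%N]card_ord -sum_nat_const.
  by rewrite big_mkcond leq_sum// => l _; case: ifP => // Ql; apply: Gb.
exists J, (fun i => S (fun k => ~~ odd (i %/ 2 ^ k)) (fun k => (i %/ 2 ^ k).+1)),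
  (fun j => S (fun k => odd (j %/ 2 ^ k)) (fun k => j %/ 2 ^ k)%N).
split=> // [i|j|i j ij jm|i j ji im]; try exact: dot_le.
  have [k [km ik jk]] := binary_branching ij jm.
  rewrite dotS (bigD1 (Ordinal km))//= (bigD1 (Ordinal km))/=; last by rewrite jk.
  rewrite jk -addnA; apply: leq_trans (leq_addr _ _).
  rewrite -(zq (code k (i %/ 2 ^ k).+1)) leq_sum// => t _.
  by case: (z _ t).
apply: dot_le => k l ik jl; apply: zD.
- rewrite /code /N; have := leq_div i (2 ^ k); have := ltn_ord k; nia.
- rewrite /code /N; have := leq_div j (2 ^ l); have := ltn_ord l; nia.
(* Equal codes force [k = l] and [i %/ 2 ^ l + 1 = j %/ 2 ^ l], impossible for [j <= i]. *)
apply/eqP => /[dup] /(congr1 (modn^~ m)) + /(congr1 (divn^~ m)).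
rewrite /code !modnMDl !divnMDl// !(modn_small (ltn_ord _)) !(divn_small (ltn_ord _)).
by move=> -> ; rewrite !addn0; have := leq_div2r (2 ^ l) ji; lia.
Qed.

Local Open Scope classical_set_scope.
Local Open Scope ring_scope.

(** * The Hilbert matrix *)

(** The difference is taken in [R], so that over an ordered field the entries below the diagonal are
    negative. *)
Definition hilb (R : fieldType) (i j : nat) : R := (2 * (j%:R - i%:R) + 1)^-1.

Definition odd_harmonic (R : fieldType) (m : nat) : R :=
  \sum_(k < m) (2 * k%:R + 1)^-1.

Section HilbertKernel.
Variable R : realFieldType.
Local Notation hilb := (hilb R).

Lemma hilb_gt0 i j : (i <= j)%N -> 0 < hilb i j.
Proof. by rewrite invr_gt0 -(ler_nat R) => ?; lra. Qed.

Lemma hilb_lt0 i j : (j < i)%N -> hilb i j < 0.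
Proof. by rewrite invr_lt0 -(ler_nat R) -natr1 => ?; lra. Qed.

Lemma hilb_den_neq0 i j : 2 * (j%:R - i%:R) + 1 != 0 :> R.
Proof.
rewrite -invr_eq0; have [/hilb_gt0 h|/hilb_lt0 h] := leqP i j.
  by rewrite gt_eqF.
by rewrite lt_eqF.
Qed.

Lemma hilbSS i j : hilb i.+1 j.+1 = hilb i j.
Proof. by congr (_^-1); rewrite -!natr1; ring. Qed.

Lemma hilb_addl i k : hilb i (i + k) = (2 * k%:R + 1)^-1.
Proof. by congr (_^-1); rewrite natrD; ring. Qed.

Lemma hilb_subl i k : (k < i)%N -> hilb i (i - k.+1) = - (2 * k%:R + 1)^-1.
Proof. by move=> ki; rewrite -invrN; congr (_^-1); rewrite natrB// -natr1; ring. Qed.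

(** Row [k.+1] is row [k] shifted right: a negative entry enters at column 0 and a positive one
    leaves at column [n]. *)
Lemma hilb_row_sum_anti n i k : (i <= k)%N -> (k < n)%N ->
  \sum_(j < n) hilb k j <= \sum_(j < n) hilb i j.
Proof.
elim: k => [|k IH]; first by rewrite leqn0 => /eqP->.
rewrite leq_eqVlt => /orP[/eqP-> //|ik] kn.
apply: le_trans (IH ik (ltnW kn)).
have := @big_ord_recr _ _ +%R n (fun j : 'I_n.+1 => hilb k.+1 j).
rewrite big_ord_recl /=; under [X in _ + X]eq_bigr do rewrite /bump add1n hilbSS.
have := @hilb_gt0 k.+1 n (ltnW kn); have := @hilb_lt0 k.+1 0 isT; lra.
Qed.

Lemma hilb_partial_fractions i k j :
  2 * (k%:R - i%:R) * (hilb i j * hilb k j) = hilb k j - hilb i j.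
Proof. by rewrite /hilb; field; rewrite !hilb_den_neq0. Qed.

(* By partial fractions the sum telescopes; over all integers j it would vanish,
   and the terms with j outside [0, n) are positive. *)
Lemma hilb_gram_le0 n i k : (i < n)%N -> (k < n)%N -> i != k ->
  \sum_(j < n) hilb i j * hilb k j <= 0.
Proof.
wlog ik : i k / (i < k)%N => [th ni nk neq|ni nk _].
  have [?|ki|e] := ltngtP i k; first exact: th.
    by under eq_bigr do rewrite mulrC; apply: th => //; rewrite eq_sym.
  by rewrite e eqxx in neq.
have ik0 : 0 < 2 * (k%:R - i%:R) :> R by rewrite pmulr_rgt0// subr_gt0 ltr_nat.
rewrite -(pmulr_rle0 _ ik0) mulr_sumr.
under eq_bigr do rewrite hilb_partial_fractions.
by rewrite sumrB subr_le0 hilb_row_sum_anti// ltnW.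
Qed.

Lemma odd_inv_square_sum m : \sum_(k < m) ((2 * k%:R + 1)^-1) ^+ 2 <= 2 :> R.
Proof.
(* The induction needs a slack term; the decrease of [2 / (m + 1)] dominates the next square. *)
suff : \sum_(k < m) ((2 * k%:R + 1)^-1) ^+ 2 <= 2 - 2 / (m%:R + 1) :> R.
  by move/le_trans; apply; rewrite gerBl divr_ge0 ?addr_ge0.
elim: m => [|m IH]; first by rewrite big_ord0 add0r divr1 subrr.
rewrite big_ord_recr /= -[m.+1%:R]natr1; apply: le_trans (lerD IH (lexx _)) _.
have m0 : 0 <= m%:R :> R by [].
rewrite -subr_ge0.
have -> : 2 - 2 / (m%:R + 1 + 1) - (2 - 2 / (m%:R + 1) + (2 * m%:R + 1)^-1 ^+ 2) =
  (7 * m%:R ^+ 2 + 5 * m%:R) / ((m%:R + 1) * (m%:R + 2) * (2 * m%:R + 1) ^+ 2) :> R.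
  by field; rewrite !lt0r_neq0//; lra.
by rewrite divr_ge0//; nra.
Qed.

Lemma hilb_diag_le n i : (i < n)%N -> \sum_(j < n) hilb i j ^+ 2 <= 4.
Proof.
move=> /ltnW /subnKC <-; rewrite big_split_ord /=.
under [X in _ + X]eq_bigr do rewrite hilb_addl.
rewrite (reindex_inj rev_ord_inj) /=.
under eq_bigr do rewrite hilb_subl// sqrrN.
by have := odd_inv_square_sum i; have := odd_inv_square_sum (n - i); lra.
Qed.

(** Expanding the squares gives the Gram matrix of the rows. As [x] is nonnegative, its off-diagonal
    part contributes at most 0, leaving the squared row norms. *)
Lemma hilb_form_le n (x : 'I_n -> R) : (forall i, 0 <= x i) ->
  \sum_(j < n) (\sum_(i < n) x i * hilb i j) ^+ 2 <= 4 * \sum_(i < n) x i ^+ 2.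
Proof.
move=> x0.
have -> : \sum_(j < n) (\sum_(i < n) x i * hilb i j) ^+ 2 =
    \sum_(i < n) \sum_(k < n) x i * x k * \sum_(j < n) hilb i j * hilb k j.
  under eq_bigr => j _.
    rewrite expr2 mulr_suml; under eq_bigr do rewrite mulr_sumr.
    over.
  rewrite exchange_big; apply: eq_bigr => i _ /=.
  rewrite exchange_big; apply: eq_bigr => k _ /=.
  by rewrite mulr_sumr; apply: eq_bigr => j _; ring.
rewrite mulr_sumr; apply: ler_sum => i _.
rewrite (bigD1 i)//= -[leRHS]addr0 lerD//.
  rewrite mulrC -expr2; apply: ler_wpM2r; first exact: sqr_ge0.
  by under eq_bigr do rewrite -expr2; apply: hilb_diag_le.
apply: sumr_le0 => k ki; rewrite mulr_ge0_le0//; first exact: mulr_ge0.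
by apply: hilb_gram_le0 => //; rewrite eq_sym.
Qed.

(** Apply [hilb_form_le] to the indicator of each colour class of rows. Each row lies in one class,
    so these bounds add up to [4 * n]. *)
Lemma hilb_coloring_fin n (Y : finType) (a b : 'I_n -> Y) :
  \sum_(i < n) \sum_(j < n) (a i == b j)%:R * hilb i j <= 2 * n%:R.
Proof.
pose F y j := \sum_(i < n) (a i == y)%:R * hilb i j.
have FY : \sum_y \sum_(j < n) F y j ^+ 2 <= 4 * n%:R.
  apply: (@le_trans _ _ (\sum_y 4 * \sum_(i < n) (a i == y)%:R ^+ 2)).
    by apply: ler_sum => y _; apply: hilb_form_le.
  rewrite -mulr_sumr exchange_big /= ler_wpM2l//.
  rewrite -[X in X%:R]card_ord -sumr_const ler_sum// => i _.
  rewrite (bigD1 (a i))//= eqxx expr1n big1 ?addr0// => y.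
  by rewrite eq_sym => /negPf->; rewrite expr0n.
(* [F <= 1 + F ^ 2 / 4] passes to squares, and each of the two terms then sums to at most [n]. *)
apply: (@le_trans _ _ (\sum_(j < n) (1 + 4^-1 * F (b j) j ^+ 2))).
  rewrite exchange_big /=; apply: ler_sum => j _; rewrite -/(F (b j) j).
  by have := sqr_ge0 (F (b j) j - 2); nra.
rewrite big_split /= sumr_const card_ord -mulr_sumr.
suff : \sum_(j < n) F (b j) j ^+ 2 <= \sum_y \sum_(j < n) F y j ^+ 2 by lra.
rewrite exchange_big /=; apply: ler_sum => j _.
rewrite (bigD1 (b j))//= lerDl sumr_ge0// => *; exact: sqr_ge0.
Qed.

(** Replacing a colour by a chosen row that carries it, or by [None], makes the colour set
    finite. *)
Lemma hilb_coloring n (Y : Type) (a b : 'I_n -> Y) :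
  \sum_(i < n) \sum_(j < n) `[< a i = b j >]%:R * hilb i j <= 2 * n%:R.
Proof.
pose rep y := [pick i | `[< a i = y >]].
suff e i j : `[< a i = b j >] = (rep (a i) == rep (b j)).
  under eq_bigr do under eq_bigr do rewrite e.
  exact: hilb_coloring_fin.
apply/asboolP/eqP => [->//|]; rewrite /rep.
case: pickP => [k /asboolP <- |/(_ i)/asboolP//].
by case: pickP => // l /asboolP <- [->].
Qed.

Lemma odd_harmonicS m : odd_harmonic R m.+1 = odd_harmonic R m + (2 * m%:R + 1)^-1.
Proof. by rewrite /odd_harmonic big_ord_recr. Qed.

Lemma hilb_upper_sum n :
  \sum_(i < n) \sum_(j < n | (i <= j)%N) hilb i j = \sum_(m < n) odd_harmonic R m.+1.
Proof.
rewrite (exchange_big_dep xpredT)//=; apply: eq_bigr => j _.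
under eq_bigl do rewrite -ltnS.
rewrite -(big_ord_widen n (hilb^~ j) (ltn_ord j)) (reindex_inj rev_ord_inj) /=.
by apply: eq_bigr => k _; rewrite subSS -(hilb_addl (j - k)) subnK// -ltnS.
Qed.

Lemma hilb_lower_sum n :
  \sum_(i < n) \sum_(j < n | (j < i)%N) - hilb i j = \sum_(m < n) odd_harmonic R m.
Proof.
apply: eq_bigr => i _.
rewrite -(big_ord_widen n (fun j => - hilb i j) (ltnW (ltn_ord i))).
rewrite (reindex_inj rev_ord_inj) /=.
by apply: eq_bigr => k _; rewrite hilb_subl// opprK.
Qed.

End HilbertKernel.

(** * Logarithmic lower bounds for sums of odd reciprocals *)

Section LogBounds.
Variable R : realType.

Lemma ln_add1_le (x : R) : 0 < x -> ln (x + 1) <= ln x + x^-1.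
Proof.
move=> x0; have -> : x + 1 = x * (1 + x^-1) by field; lra.
have xV : 0 < x^-1 by rewrite invr_gt0.
by rewrite lnM ?posrE ?lerD2l ?le_ln1Dx//; lra.
Qed.

(** Termwise, [2 / (2m + 1) >= 1 / (m + 1) >= ln (m + 2) - ln (m + 1)]. *)
Lemma ln_le_odd_harmonic (m : nat) : ln m.+1%:R <= 2 * odd_harmonic R m.
Proof.
elim: m => [|m IH]; first by rewrite ln1 /odd_harmonic big_ord0 mulr0.
rewrite odd_harmonicS -[m.+2%:R]natr1.
apply: le_trans (ln_add1_le _) _; first by rewrite ltr0n.
rewrite mulrDr lerD// -natr1 -[leRHS]invrK invfM invrK lef_pV2 ?posrE//; have : 0 <= m%:R :> R by []; lra.
Qed.

Lemma odd_harmonic_sum_ge (n : nat) :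
  n%:R * ln n%:R - n%:R <= 2 * \sum_(m < n) odd_harmonic R m.+1.
Proof.
elim: n => [|n IH]; first by rewrite big_ord0 mul0r subrr mulr0.
rewrite big_ord_recr /= mulrDr.
suff : n.+1%:R * ln n.+1%:R - n.+1%:R <=
       n%:R * ln n%:R - n%:R + 2 * odd_harmonic R n.+1 :> R by lra.
have h := ln_le_odd_harmonic n; rewrite odd_harmonicS.
have n0 : 0 <= n%:R :> R by [].
have i0 : 0 < (2 * n%:R + 1)^-1 :> R by rewrite invr_gt0; lra.
suff : n%:R * ln (n%:R + 1) <= n%:R * ln n%:R + 1 :> R.
  by move: h; rewrite -natr1; lra.
have [->|/negbTE nN0] := eqVneq n 0%N; first by rewrite !mul0r; lra.
have np : 0 < n%:R :> R by rewrite ltr0n lt0n nN0.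
by have := ler_wpM2l n0 (ln_add1_le np); rewrite mulrDr mulfV// gt_eqF.
Qed.

End LogBounds.

Lemma ln2_ge_half (R : realType) : 2^-1 <= ln 2 :> R.
Proof.
have := @le_ln1Dx R (- 2^-1); have -> : 1 + - 2^-1 = 2^-1 :> R by lra.
by rewrite lnV ?posrE// => h; have := h ltac:(lra); lra.
Qed.

(** Supplies the field size for the Reed-Solomon vectors. *)
Lemma pow2_between (R : realType) (x : R) : 1 <= x ->
  exists e : nat, [/\ (0 < e)%N, x < (2 ^ e)%:R & (2 ^ e)%:R <= 2 * x].
Proof.
move=> x1; have x0 : 0 <= x by lra.
have t0 : (0 < Num.truncn x)%N by rewrite truncn_gt0.
have /andP[lo hi] := trunc_log_bounds (isT : (1 < 2)%N) t0.
exists (trunc_log 2 (Num.truncn x)).+1; split=> //.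
  by apply: lt_le_trans (truncnS_gt x) _; rewrite ler_nat.
rewrite expnS natrM ler_wpM2l//; apply: (@le_trans _ _ (Num.truncn x)%:R).
  by rewrite ler_nat.
by rewrite truncn_le.
Qed.

(** * Staircases bound the gap *)

(** Linearity of expectation, for weights of either sign. *)
Lemma sum_probability_le (R : realType) (dsp : measure_display)
    (T : measurableType dsp) (P : probability T R) (I : finType)
    (k : I -> R) (E : I -> set T) (b : R) :
  (forall i, measurable (E i)) ->
  (forall w, \sum_i k i * \1_(E i) w <= b) ->
  \sum_i k i * fine (P (E i)) <= b.
Proof.
move=> mE Eb; rewrite -lee_fin.
have iE i : P.-integrable setT (fun w => (k i)%:E * (\1_(E i) w)%:E)%E.
  by apply: integrableZl => //; apply: integrable_indic.
have -> : (\sum_i k i * fine (P (E i)))%:E =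
    (\int[P]_w \sum_i (k i)%:E * (\1_(E i) w)%:E)%E.
  rewrite integral_sum// -sumEFin; apply: eq_bigr => i _.
  rewrite integralZl//; last exact: integrable_indic.
  by rewrite integral_indic// setIT EFinM fineK// fin_num_measure.
have <- : (\int[P]_w b%:E = b%:E)%E.
  by have := expectation_cst P b; rewrite unlock.
apply: le_integral => //.
- exact: integrable_sum.
- exact: finite_measure_integrable_cst.
by move=> w _; under eq_bigr do rewrite -EFinM; rewrite sumEFin lee_fin.
Qed.

(** With [U] the sum of the positive weights and [L] that of the negative ones in absolute value,
    [P1 * U - P2 * L <= 2 * n]. Since [0 <= P2] and [L <= U], this bounds [(P1 - P2) * U]; then
    [n * ln n - n <= 2 * U] and [P1 - P2 <= 1] give [4 + 1 = 5]. *)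
Lemma staircase_gap (R : realType) (d : nat) (dsp : measure_display)
    (T : measurableType dsp) (P : probability T R) (Y : Type)
    (hp hq : T -> 'rV[R]_d -> Y) (sim : 'rV[R]_d -> 'rV[R]_d -> R)
    (Dp Dq : set 'rV[R]_d) (s cs P1 P2 : R) (n : nat) (p q : nat -> 'rV[R]_d) :
  is_ALSH P hp hq sim Dp Dq s cs P1 P2 ->
  (forall i, (i < n)%N -> Dp (p i)) -> (forall j, (j < n)%N -> Dq (q j)) ->
  (forall i j, (i <= j)%N -> (j < n)%N -> s <= sim (p i) (q j)) ->
  (forall i j, (j < i)%N -> (i < n)%N -> sim (p i) (q j) < cs) ->
  (P1 - P2) * ln n%:R <= 5.
Proof.
move=> H Dpp Dqq up low.
(* Without a pair below the diagonal nothing constrains [P2], but then [ln n] is 0, with [ln 0 = 0]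
   by convention. *)
have [n1|n1] := leqP n 1.
  suff -> : ln n%:R = 0 :> R by rewrite mulr0.
  by move: n1; case: (n) => [|[|]]// _; [exact: ln0|exact: ln1].
have n0 : 0 < n%:R :> R by rewrite ltr0n ltnW.
have lnn0 : 0 <= ln n%:R :> R by rewrite ln_ge0// ler1n ltnW.
have [P12|P12] := leP P1 P2.
  by apply: (@le_trans _ _ 0) => //; apply: mulr_le0_ge0 => //; lra.
have Hij (i j : 'I_n) := H (p i) (q j) (Dpp i (ltn_ord i)) (Dqq j (ltn_ord j)).
pose E i j := hash_collision hp hq (p i) (q j).
pose pr i j := fine (P (E i j)).
have mE (i j : 'I_n) : measurable (E i j) by case: (Hij i j).
have prE (i j : 'I_n) : P (E i j) = (pr i j)%:E by rewrite fineK// fin_num_measure.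
have pr_up (i j : 'I_n) : (i <= j)%N -> P1 <= pr i j.
  move=> ij; rewrite -lee_fin -prE.
  by case: (Hij i j) => _ + _; apply; exact: up.
have pr_low (i j : 'I_n) : (j < i)%N -> pr i j <= P2.
  move=> ij; rewrite -lee_fin -prE.
  by case: (Hij i j) => _ _; apply; exact: low.
have P1_1 : P1 <= 1.
  apply: le_trans (pr_up (Ordinal (ltnW n1)) (Ordinal (ltnW n1)) (leqnn _)) _.
  by rewrite -lee_fin -prE probability_le1.
have P2_0 : 0 <= P2.
  apply: le_trans (pr_low (Ordinal n1) (Ordinal (ltnW n1)) isT).
  by rewrite -lee_fin -prE.
have tot : \sum_(i < n) \sum_(j < n) hilb R i j * pr i j <= 2 * n%:R.
  rewrite pair_big /=.
  apply: (@sum_probability_le _ _ _ P _ (fun ij : 'I_n * 'I_n => hilb R ij.1 ij.2)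
           (fun ij => E ij.1 ij.2)) => [[i j]|w]; first exact: mE.
  apply: le_trans (@hilb_coloring R n Y (fun i => hp w (p i)) (fun j => hq w (q j))).
  rewrite pair_big /= le_eqVlt; apply/orP; left; apply/eqP.
  apply: eq_bigr => ij _; by rewrite mulrC indicE; congr (_%:R * _).
pose U := \sum_(m < n) odd_harmonic R m.+1.
pose L := \sum_(m < n) odd_harmonic R m.
have LU : L <= U.
  apply: ler_sum => m _; rewrite odd_harmonicS lerDl invr_ge0.
  by have : 0 <= m%:R :> R by []; lra.
have UL : P1 * U - P2 * L <= 2 * n%:R.
  apply: le_trans tot.
  rewrite /U /L -hilb_upper_sum -hilb_lower_sum !mulr_sumr -sumrB.
  apply: ler_sum => i _; rewrite !mulr_sumr [leRHS](bigID (fun j : 'I_n => (i <= j)%N)) /=.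
  rewrite -sumrN; apply: lerD.
    apply: ler_sum => j ij; rewrite mulrC ler_wpM2l ?pr_up//.
    exact/ltW/hilb_gt0.
  rewrite [leRHS](eq_bigl (fun j : 'I_n => (j < i)%N)); last by move=> j; rewrite ltnNge.
  apply: ler_sum => j ji; rewrite mulrN opprK mulrC ler_wnM2l ?pr_low//.
  exact/ltW/hilb_lt0.
have Un := odd_harmonic_sum_ge R n; rewrite -/U in Un.
have PU : (P1 - P2) * U <= 2 * n%:R.
  by apply: le_trans UL; rewrite mulrBl lerD2l lerN2 ler_wpM2l.
have : (P1 - P2) * (n%:R * ln n%:R - n%:R) <= (P1 - P2) * (2 * U).
  by rewrite ler_wpM2l// subr_ge0 ltW.
have : (P1 - P2) * n%:R <= n%:R by rewrite ler_piMl ?ler0n//; lra.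
move=> h1 h2; rewrite -(ler_pM2l n0); lra.
Qed.

(** Staircases can thus use any small finite type of coordinates; the others are padded with 0. *)
Lemma ips_embedding (R : realType) (d : nat) (I : finType) : (#|I| <= d)%N ->
  exists e : (I -> R) -> 'rV[R]_d,
    forall f g, ips_dot (e f) (e g) = \sum_i f i * g i.
Proof.
move=> Id.
pose c (f : I -> R) (k : nat) : R :=
  if insub k is Some r then f (@enum_val I predT r) else 0.
exists (fun f => \row_k c f k) => f g; rewrite /ips_dot.
under eq_bigr do rewrite !mxE.
rewrite (bigID (fun k : 'I_d => (k < #|I|)%N)) /= [X in _ + X]big1 ?addr0; last first.
  by move=> k kI; rewrite /c insubN// mul0r.
rewrite -(big_ord_widen d (fun k => c f k * c g k) Id) [RHS](reindex (@enum_val I predT)) /=.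
  by apply: eq_bigr => k _; rewrite /c valK.
exact/onW_bij/enum_val_bij.
Qed.

(** * Staircases from unit vectors and on a line *)

Section ALSH.
Variables (R : realType) (dsp : measure_display) (T : measurableType dsp).
Variables (P : probability T R) (Y : Type) (unsigned : bool) (d : nat).
Variables (hp hq : T -> 'rV[R]_d -> Y) (U c s P1 P2 : R).
Hypothesis lsh : is_ALSH P hp hq (ips_sim unsigned) (origin_ball d 1)
  (origin_ball d U) s (c * s) P1 P2.
Hypotheses (c01 : 0 < c < 1) (s0 : 0 < s).

(** On a line, the data point 1 against the queries [s] and 0 forces [P1 <= 1] and [0 <= P2]. *)
Lemma alsh_gap_le1 : (1 <= d)%N -> s <= U -> P1 - P2 <= 1.
Proof.
move=> d1 sU; have [e dote] := @ips_embedding R d 'I_1 ltac:(by rewrite card_ord).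
have cs0 : 0 < c * s by case/andP: c01 => ? _; apply: mulr_gt0.
have ball (a r : R) : 0 <= a <= r -> origin_ball d r (e (fun=> a)).
  by rewrite /origin_ball /= dote big_ord1 => ?; nra.
have sim0 : ips_sim unsigned (e (fun=> 1)) (e (fun=> 0)) = 0.
  by rewrite /ips_sim dote big_ord1 mulr0 normr0 if_same.
have sims : ips_sim unsigned (e (fun=> 1)) (e (fun=> s)) = s.
  by rewrite /ips_sim dote big_ord1 mul1r gtr0_norm// if_same.
have sU' : 0 <= s <= U by rewrite (ltW s0).
have U0 : 0 <= (0 : R) <= U by rewrite lexx; exact: le_trans (ltW s0) sU.
have h11 : 0 <= (1 : R) <= 1 by rewrite ler01 lexx.
have [mh + _] := lsh (ball 1 1 h11) (ball s U sU').
rewrite sims => /(_ (lexx _)) h1.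
have [_ _ +] := lsh (ball 1 1 h11) (ball 0 U U0).
rewrite sim0 => /(_ cs0) h2.
have : P1 <= 1 by rewrite -lee_fin (le_trans h1)// probability_le1.
have : 0 <= P2 by rewrite -lee_fin; exact: le_trans (measure_ge0 _ _) h2.
lra.
Qed.

(** An absolute value only helps on and above the diagonal; below it, the sign condition makes it
    harmless. *)
Lemma alsh_staircase (I : finType) (n : nat) (x y : nat -> I -> R) :
  (#|I| <= d)%N ->
  (forall i, (i < n)%N -> \sum_t x i t * x i t <= 1) ->
  (forall j, (j < n)%N -> \sum_t y j t * y j t <= U ^+ 2) ->
  (forall i j, (i <= j)%N -> (j < n)%N -> s <= \sum_t x i t * y j t) ->
  (forall i j, (j < i)%N -> (i < n)%N -> \sum_t x i t * y j t < c * s) ->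
  (unsigned -> forall i j, (j < i)%N -> (i < n)%N -> 0 <= \sum_t x i t * y j t) ->
  (P1 - P2) * ln n%:R <= 5.
Proof.
move=> Id x1 yU up low pos; have [e dote] := @ips_embedding R d I Id.
apply: (staircase_gap lsh (p := fun i => e (x i)) (q := fun j => e (y j))).
- by move=> i ni; rewrite /origin_ball /= dote expr1n x1.
- by move=> j nj; rewrite /origin_ball /= dote yU.
- move=> i j ij nj; rewrite /ips_sim dote; case: unsigned; last exact: up.
  exact: le_trans (up _ _ ij nj) (ler_norm _).
- move=> i j ji ni; rewrite /ips_sim dote; have := low _ _ ji ni.
  by case: unsigned pos => // /(_ isT) pos; rewrite ger0_norm// pos.
Qed.

Lemma alsh_gap_dim : s ^+ 2 * d%:R <= U ^+ 2 -> (P1 - P2) * ln d%:R <= 5.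
Proof.
move=> sU.
have dot (i : nat) (f : nat -> R) : (i < d)%N ->
    \sum_(k < d) (k == i :> nat)%:R * f k = f i.
  move=> id; rewrite (bigD1 (Ordinal id))//= eqxx mul1r big1 ?addr0// => k.
  by move=> ki; rewrite (negPf (ki : (k != i :> nat))) mul0r.
apply: (@alsh_staircase 'I_d d (fun i k => (k == i :> nat)%:R)
          (fun j k => s * (k <= j)%N%:R)).
- by rewrite card_ord.
- by move=> i id; rewrite (dot i (fun k => (k == i)%:R))// eqxx.
- move=> j _; apply: le_trans sU.
  rewrite -[X in _ * X%:R]card_ord -sumr_const mulr_sumr; apply: ler_sum => k _.
  by case: (k <= j)%N; rewrite ?mulr1 ?mulr0 ?mulr1 ?sqr_ge0.
- move=> i j ij jd; rewrite (dot i (fun k => s * (k <= j)%N%:R)) ?ij ?mulr1//.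
  exact: leq_ltn_trans jd.
- move=> i j ji id; rewrite (dot i (fun k => s * (k <= j)%N%:R))//.
  by rewrite leqNgt ji mulr0; case/andP: c01 => ? _; apply: mulr_gt0.
- move=> _ i j ji id; rewrite (dot i (fun k => s * (k <= j)%N%:R))//.
  by rewrite leqNgt ji mulr0.
Qed.

(** The ratio is [c ^+ 2] because ratio [c] would give products equal to [c * s] just below the
    diagonal, where strict inequality is required. *)
Lemma alsh_gap_geometric (n : nat) : (1 <= d)%N -> s <= U * c ^+ (2 * n) ->
  (P1 - P2) * ln n.+1%:R <= 5.
Proof.
move=> d1 sU; have [c0 c1] := andP c01.
have t0 : 0 < c ^+ 2 by rewrite exprn_gt0.
have t1 : c ^+ 2 <= 1 by rewrite exprn_ile1// ltW.
have tn0 k : 0 < c ^+ 2 ^+ k by rewrite exprn_gt0.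
have U0 : 0 <= U.
  rewrite -(pmulr_lge0 U (tn0 n)) -exprM.
  exact: le_trans (ltW s0) sU.
have low i j : (j < i)%N -> c ^+ 2 ^+ i * (s / c ^+ 2 ^+ j) = s * c ^+ 2 ^+ (i - j).
  by move=> ji; rewrite -{1}(subnK (ltnW ji)) exprD; field; rewrite gt_eqF.
apply: (@alsh_staircase 'I_1 n.+1 (fun i _ => c ^+ 2 ^+ i)
          (fun j _ => s / c ^+ 2 ^+ j)).
- by rewrite card_ord.
- by move=> i _; rewrite big_ord1 -expr2 -exprM exprn_ile1// ltW.
- move=> j; rewrite ltnS => jn; rewrite big_ord1 -expr2.
  have h : s / c ^+ 2 ^+ j <= U.
    rewrite ler_pdivrMr//; apply: le_trans sU _; rewrite exprM ler_wpM2l//.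
    by rewrite ler_wiXn2l// ltW.
  have h0 : 0 <= s / c ^+ 2 ^+ j by rewrite divr_ge0// ltW.
  by rewrite ler_sqr// nnegrE; apply: le_trans h.
- move=> i j ij _; rewrite big_ord1 mulrCA -[leLHS]mulr1 ler_wpM2l ?(ltW s0)//.
  by rewrite ler_pdivlMr// mul1r ler_wiXn2l// ltW.
- move=> i j ji _; rewrite big_ord1 low// mulrC ltr_pM2r//.
  apply: (@le_lt_trans _ _ (c ^+ 2)); last by rewrite expr2 gtr_pMr.
  rewrite -[leRHS]expr1 ler_wiXn2l// ?subn_gt0//; exact: ltW.
- move=> _ i j ji _; rewrite big_ord1 low// mulr_ge0// ltW//.
Qed.

End ALSH.

(** * Long staircases *)

Section LongStaircases.
Variables (R : realType) (dsp : measure_display) (T : measurableType dsp).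
Variables (P : probability T R) (Y : Type) (unsigned : bool) (d : nat).
Variables (hp hq : T -> 'rV[R]_d -> Y) (U c s P1 P2 : R).

(** The logarithm splits into [ln d], handled by unit vectors, and [ln L], handled by the line:
    [5 + 5], plus 1 for rounding [L / 2]. *)
Lemma alsh_gap_ladder :
  is_ALSH P hp hq (ips_sim unsigned) (origin_ball d 1) (origin_ball d U) s (c * s) P1 P2 ->
  (1 <= d)%N -> 0 < c < 1 -> 0 < s ->
  s <= c * U -> s <= U / (4 * Num.sqrt d%:R) ->
  (P1 - P2) * ln (d%:R * (ln (U / s) / ln c^-1)) <= 11.
Proof.
move=> lsh d1 c01 s0 scU sUd; have [c0 c1] := andP c01.
have U0 : 0 < U by rewrite -(pmulr_rgt0 _ c0); apply: lt_le_trans scU.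
have sU : s <= U by apply: le_trans scU _; rewrite ler_piMl ?ltW.
have dR : 1 <= d%:R :> R by rewrite ler1n.
have lnc : 0 < ln c^-1 by rewrite ln_gt0// invf_gt1.
set L := ln (U / s) / ln c^-1.
have L1 : 1 <= L.
  rewrite /L ler_pdivlMr// mul1r ler_ln ?posrE ?invr_gt0 ?divr_gt0//.
  by rewrite ler_pdivlMr// ler_pdivrMl.
have dL1 : 1 <= d%:R * L by nra.
have [P12|P12] := leP P1 P2.
  apply: (@le_trans _ _ 0) => //; apply: mulr_le0_ge0; first by rewrite subr_le0.
  exact: ln_ge0.
have gap1 := alsh_gap_le1 lsh c01 s0 d1 sU.
have gapd : (P1 - P2) * ln d%:R <= 5.
  apply: (alsh_gap_dim lsh c01 s0 _).
  have sq0 : 0 < Num.sqrt d%:R :> R by rewrite sqrtr_gt0; lra.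
  have h : s * Num.sqrt d%:R <= U.
    move: sUd; rewrite ler_pdivlMr ?mulr_gt0// => h.
    have : 0 < s * Num.sqrt d%:R by rewrite mulr_gt0.
    move: h; rewrite mulrCA; lra.
  have <- : (s * Num.sqrt d%:R) ^+ 2 = s ^+ 2 * d%:R by rewrite exprMn sqr_sqrtr//; lra.
  by rewrite ler_sqr ?nnegrE ?(ltW U0)// mulr_ge0// ltW.
pose n := Num.truncn (L / 2).
have gapL : (P1 - P2) * ln n.+1%:R <= 5.
  apply: (alsh_gap_geometric lsh c01 s0 d1 _).
  have nL : n%:R <= L / 2 by rewrite truncn_le; lra.
  rewrite -ler_pdivrMl// -ler_ln ?posrE ?mulr_gt0 ?invr_gt0 ?exprn_gt0//.
  have -> : ln (U^-1 * s) = - ln (U / s).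
    by rewrite -lnV ?posrE ?divr_gt0// invf_div mulrC.
  have lncN : ln c = - ln c^-1 by rewrite lnV ?posrE// opprK.
  rewrite lnXn// lncN mulNrn lerN2.
  rewrite -mulr_natl -ler_pdivlMr// -/L natrM; lra.
have ln2 : ln 2 <= 1 :> R by have := @le_ln1Dx R 1; rewrite -[1 + 1]/2; apply; lra.
have L0 : 0 < L by lra.
have Ln : ln L <= ln 2 + ln n.+1%:R.
  have n1 : 0 < n.+1%:R :> R by rewrite ltr0n.
  have n2 : 0 < 2 * n.+1%:R :> R by rewrite mulr_gt0.
  rewrite -lnM ?posrE// ler_ln ?posrE//.
  by have := truncnS_gt (L / 2); rewrite -/n; lra.
have -> : ln (d%:R * L) = ln d%:R + ln L.
  by apply: lnM; rewrite posrE//; lra.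
have : (P1 - P2) * ln L <= (P1 - P2) * (ln 2 + ln n.+1%:R).
  by rewrite ler_wpM2l// subr_ge0 ltW.
nra.
Qed.

(** The products fall linearly in [i - j] and may become negative, hence the restriction to signed
    similarity. Just below the diagonal they are [s * (1 - 2 * h) < c * s]. *)
Lemma alsh_gap_signed :
  is_ALSH P hp hq (ips_sim false) (origin_ball d 1) (origin_ball d U) s (c * s) P1 P2 ->
  (2 <= d)%N -> 0 < c < 1 -> 0 < s -> s <= U / (2 * d%:R) ->
  (P1 - P2) * ln (d%:R * U / (s * (1 - c))) <= 27.
Proof.
move=> lsh d2 c01 s0 sUd; have [c0 c1] := andP c01.
have dR : 2 <= d%:R :> R by rewrite (ler_nat R 2).
have sdU : 2 * d%:R * s <= U by rewrite mulrC -ler_pdivlMr// mulr_gt0//; lra.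
have sU4 : 4 * s <= U by nra.
have U0 : 0 < U by lra.
have gap1 : P1 - P2 <= 1 by apply: (alsh_gap_le1 lsh c01 s0 _ _); [exact: ltnW|lra].
pose w := U / s.
have Uw : U = w * s by rewrite /w; field; lra.
have w4 : 4 <= w by rewrite /w ler_pdivlMr.
have dw : 2 * d%:R <= w by rewrite /w ler_pdivlMr.
pose h := 1 - c.
have h0 : 0 < h by rewrite /h; lra.
have h1 : h < 1 by rewrite /h; lra.
(* Indices with [i ^ 2 <= X] satisfy [h * i ^ 2 <= w / 16], which keeps both families in their
   balls. *)
pose X := w / (16 * h).
have X0 : 0 < X by rewrite divr_gt0//; lra.
have Xh : X * h = w / 16 by rewrite /X; field; lra.
have [P12|P12] := leP P1 P2.
  apply: (@le_trans _ _ 0) => //; apply: mulr_le0_ge0; first by rewrite subr_le0.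
  apply: ln_ge0; rewrite ler_pdivlMr ?mulr_gt0// mul1r -/h; nra.
pose n := Num.truncn (Num.sqrt X).
have nX (i : nat) : (i < n.+1)%N -> i%:R ^+ 2 <= X.
  rewrite ltnS => i_n; rewrite -(sqr_sqrtr (ltW X0)) ler_sqr ?nnegrE ?sqrtr_ge0//.
  apply: le_trans (_ : n%:R <= _); first by rewrite ler_nat.
  by rewrite truncn_le sqrtr_ge0.
pose a := Num.sqrt w^-1; pose b := Num.sqrt w * s; pose g := Num.sqrt (2 * h).
have a2 : a * a = w^-1 by rewrite -expr2 sqr_sqrtr// invr_ge0; lra.
have w2 : Num.sqrt w * Num.sqrt w = w by rewrite -expr2 sqr_sqrtr//; lra.
have g2 : g * g = 2 * h by rewrite -expr2 sqr_sqrtr//; lra.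
have ab : a * b = s.
  rewrite /a /b mulrA -sqrtrM ?invr_ge0; last lra.
  by rewrite mulVf ?sqrtr1 ?mul1r//; lra.
have gap : (P1 - P2) * ln n.+1%:R <= 5.
  pose x (i : nat) (t : bool) := a * (if t then g else 1 - 2 * h * i%:R).
  pose y (j : nat) (t : bool) := b * (if t then j%:R * g else 1).
  have dot i j : \sum_t x i t * y j t = s * (1 + 2 * h * (j%:R - i%:R)).
    rewrite big_bool /x /y /=.
    have -> : a * g * (b * (j%:R * g)) + a * (1 - 2 * h * i%:R) * (b * 1) =
      a * b * (1 - 2 * h * i%:R + j%:R * (g * g)) by ring.
    by rewrite ab g2; ring.
  apply: (alsh_staircase lsh (I := bool) (x := x) (y := y)).
  - by rewrite card_bool.
  - move=> i /nX iX; rewrite big_bool /x /=.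
    have -> : a * g * (a * g) + a * (1 - 2 * h * i%:R) * (a * (1 - 2 * h * i%:R)) =
      a * a * (g * g + (1 - 2 * h * i%:R) ^+ 2) by ring.
    rewrite a2 g2 ler_pdivrMl ?mulr1; last lra.
    have i0 : 0 <= i%:R :> R by [].
    have ih : h * i%:R ^+ 2 <= w / 16 by nra.
    nra.
  - move=> j /nX jX; rewrite big_bool /y /=.
    have -> : b * (j%:R * g) * (b * (j%:R * g)) + b * 1 * (b * 1) =
      (Num.sqrt w * Num.sqrt w) * s ^+ 2 * (1 + (g * g) * j%:R ^+ 2) by rewrite /b; ring.
    rewrite w2 g2 Uw exprMn mulrAC ler_wpM2r ?sqr_ge0// expr2 ler_wpM2l//; first lra.
    have : h * j%:R ^+ 2 <= w / 16 by nra.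
    lra.
  - move=> i j ij _; rewrite dot -[leLHS]mulr1 ler_wpM2l//; first exact: ltW.
    have : i%:R <= j%:R :> R by rewrite ler_nat.
    nra.
  - move=> i j ji _; rewrite dot mulrC ltr_pM2r//.
    have : j%:R + 1 <= i%:R :> R by rewrite natr1 ler_nat.
    by rewrite /h in h0 h1 *; nra.
  - by [].
have lnX : ln X <= 2 * ln n.+1%:R.
  have -> : ln X = 2 * ln (Num.sqrt X).
    by rewrite -{1}(sqr_sqrtr (ltW X0)) lnXn ?sqrtr_gt0// mulr_natl.
  rewrite ler_wpM2l//.
  by rewrite ler_ln ?posrE ?sqrtr_gt0// ltW// truncnS_gt.
have ln2 : ln 2 <= 1 :> R by have := @le_ln1Dx R 1; rewrite -[1 + 1]/2; apply; lra.
(* Uses [d <= w / 2] and [h < 1]. With [ln X <= 2 * ln n.+1] the final constant is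
   [7 + 4 * 5 = 27]. *)
have le_X : d%:R * U / (s * (1 - c)) <= 2 ^+ 7 * X ^+ 2.
  have -> : d%:R * U / (s * (1 - c)) = d%:R * w / h.
    by rewrite Uw /h; field; rewrite !gt_eqF//; lra.
  have -> : 2 ^+ 7 * X ^+ 2 = (w * w / h / 2) / h.
    by rewrite /X; field; rewrite gt_eqF.
  rewrite ler_pM2r ?invr_gt0//.
  have wh : w * w <= w * w / h by rewrite ler_pdivlMr//; nra.
  by nra.
have : ln (d%:R * U / (s * (1 - c))) <= 7 + 4 * ln n.+1%:R.
  apply: (@le_trans _ _ (ln (2 ^+ 7 * X ^+ 2))).
    have d0 : 0 < d%:R :> R by lra.
    by rewrite ler_ln ?posrE// ?divr_gt0 ?(mulr_gt0 d0)// mulr_gt0 ?exprn_gt0.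
  have -> : ln (2 ^+ 7 * X ^+ 2) = 7 * ln 2 + 2 * ln X.
    by rewrite lnM ?posrE ?exprn_gt0// !lnXn// !mulr_natl.
  by lra.
move=> hln; have : (P1 - P2) * ln (d%:R * U / (s * (1 - c))) <=
    (P1 - P2) * (7 + 4 * ln n.+1%:R) by rewrite ler_wpM2l// subr_ge0 ltW.
have : (P1 - P2) * 7 <= 7 by rewrite ler_piMl.
have -> : (P1 - P2) * (7 + 4 * ln n.+1%:R) =
    (P1 - P2) * 7 + 4 * ((P1 - P2) * ln n.+1%:R) by ring.
lra.
Qed.

Lemma alsh_gap_high_dim :
  is_ALSH P hp hq (ips_sim unsigned) (origin_ball d 1) (origin_ball d U) s (c * s) P1 P2 ->
  0 < c < 1 -> 0 < s ->
  36 * (U ^+ 5 / (c ^+ 2 * s ^+ 5)) < d%:R -> s <= U / 8 ->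
  P1 - P2 <= 40 * Num.sqrt (s / U).
Proof.
move=> lsh c01 s0 dlarge sU8; have [c0 c1] := andP c01.
have [P12|P12] := leP P1 P2.
  by apply: (@le_trans _ _ 0); rewrite ?subr_le0// mulr_ge0// sqrtr_ge0.
have U0 : 0 < U by lra.
pose w := U / s.
have Uw : U = w * s by rewrite /w; field; lra.
have w8 : 8 <= w by rewrite /w ler_pdivlMr//; lra.
have w0 : 0 <= w by lra.
pose v := Num.sqrt w.
have v0 : 0 <= v := sqrtr_ge0 w.
have v2 : v ^+ 2 = w by rewrite sqr_sqrtr.
(* From [8 / 3] on, [v - 2 >= v / 4], so [m - 1 >= v / 4] despite rounding. *)
have v83 : 8 / 3 <= v by nra.
pose m := Num.truncn v.
have mv : m%:R <= v by rewrite truncn_le.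
have vm : v < m%:R + 1 by rewrite natr1; exact: truncnS_gt.
have m0 : (0 < m)%N by rewrite truncn_gt0; lra.
have mR1 : 1 <= m%:R :> R by rewrite ler1n.
have mw : m%:R ^+ 2 <= w by rewrite -v2 ler_sqr ?nnegrE.
(* A field size [q > x0] makes the unwanted overlaps, at most [3 * m ^ 3], smaller than [c * q]. As
   [q <= 2 * x0], dimension [q ^ 2] is at most [36 * m ^ 6 / c ^ 2]. *)
pose x0 : R := 3 * m%:R ^+ 3 / c.
have m3 : 1 <= m%:R ^+ 3 :> R by rewrite exprn_ege1.
have x01 : 1 <= x0 by rewrite /x0 ler_pdivlMr//; lra.
have [e [e0 xe ex]] := pow2_between x01.
have [J [X [Z [cJ XX ZZ XZ_up XZ_low]]]] := comparison_vectors e0 m0.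
pose q : R := (2 ^ e)%:R; rewrite -/q in xe ex.
have q0 : 0 < q by lra.
have Jd : (#|J| <= d)%N.
  rewrite -(ler_nat R) cJ natrM -/q; apply: le_trans (ltW dlarge).
  have -> : U ^+ 5 / (c ^+ 2 * s ^+ 5) = w ^+ 5 / c ^+ 2.
    by rewrite Uw; field; rewrite !gt_eqF.
  apply: (@le_trans _ _ ((2 * x0) * (2 * x0))); first by rewrite ler_pM// ltW.
  have -> : 2 * x0 * (2 * x0) = 36 * ((m%:R ^+ 2) ^+ 3 / c ^+ 2).
    by rewrite /x0; field; rewrite gt_eqF.
  rewrite ler_wpM2l// ler_wpM2r ?invr_ge0 ?sqr_ge0//.
  apply: (@le_trans _ _ (w ^+ 3)); first by rewrite lerXn2r ?nnegrE ?exprn_ge0.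
  by rewrite ler_weXn2l//; lra.
pose r := Num.sqrt q; pose a := (m%:R * r)^-1; pose b := s * m%:R / r.
have r0 : 0 < r by rewrite sqrtr_gt0.
have q2 : q = r ^+ 2 by rewrite sqr_sqrtr// ltW.
(* The shift [j.+1] turns the strict comparison [i < j] into [i <= j], at the cost of one step:
   [2 ^ m - 1] remain. *)
pose x i (t : J) : R := a * (X i t)%:R; pose y j (t : J) : R := b * (Z j.+1 t)%:R.
have dot (f g : J -> nat) (k l : R) :
    \sum_t (k * (f t)%:R) * (l * (g t)%:R) = k * l * (\sum_t f t * g t)%N%:R.
  by rewrite natr_sum mulr_sumr; apply: eq_bigr => t _; rewrite natrM; ring.
have gap : (P1 - P2) * ln (2 ^ m).-1%:R <= 5.
  have m2n (j : nat) : (j < (2 ^ m).-1)%N -> (j.+1 < 2 ^ m)%N.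
    by rewrite -ltnS prednK// expn_gt0.
  have ab : a * b = s / q.
    by rewrite q2 /a /b; field; rewrite !gt_eqF ?ltr0n.
  apply: (alsh_staircase lsh (x := x) (y := y) Jd).
  - move=> i _; rewrite dot.
    have aa0 : 0 <= a * a by rewrite -expr2 sqr_ge0.
    have := XX i; rewrite -(ler_nat R) !natrM -/q => /(ler_wpM2l aa0)/le_trans; apply.
    rewrite le_eqVlt; apply/orP; left; apply/eqP.
    by rewrite q2 /a; field; rewrite !gt_eqF ?ltr0n.
  - move=> j _; rewrite dot.
    have bb0 : 0 <= b * b by rewrite -expr2 sqr_ge0.
    have := ZZ j.+1; rewrite -(ler_nat R) !natrM -/q => /(ler_wpM2l bb0)/le_trans; apply.
    have -> : b * b * (m%:R * m%:R * q) = s ^+ 2 * (m%:R ^+ 2) ^+ 2.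
      by rewrite q2 /b; field; rewrite !gt_eqF.
    have -> : U ^+ 2 = s ^+ 2 * w ^+ 2 by rewrite {1}Uw; ring.
    by rewrite ler_wpM2l ?sqr_ge0// ler_sqr ?nnegrE ?sqr_ge0.
  - move=> i j ij /m2n jn; rewrite dot ab.
    have := XZ_up i j.+1 ij jn; rewrite -(ler_nat R) -/q => h.
    by rewrite mulrAC ler_pdivlMr// ler_wpM2l// ltW.
  - move=> i j ji /m2n/ltnW im; rewrite dot ab.
    have := XZ_low i j.+1 ji im; rewrite -(ler_nat R) !natrM => h.
    rewrite mulrAC ltr_pdivrMr// -mulrA (mulrC c) -mulrA ltr_pM2l//.
    apply: le_lt_trans h _; move: xe; rewrite /x0 ltr_pdivrMr// => xe.
    have -> : m%:R * m%:R * (3 * m%:R) = 3 * m%:R ^+ 3 :> R by ring.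
    by [].
  - by move=> _ i j _ _; rewrite dot ab mulr_ge0// divr_ge0// ltW.
have lnm : (m%:R - 1) * 2^-1 <= ln (2 ^ m).-1%:R :> R.
  apply: (@le_trans _ _ (ln (2 ^ m.-1)%:R)).
    rewrite natrX lnXn// -(mulr_natl (ln 2)) -subn1 natrB// ler_wpM2l ?subr_ge0//.
    exact: ln2_ge_half.
  have p0 : (0 < 2 ^ m.-1)%N by rewrite expn_gt0.
  have p12 : (2 ^ m.-1 <= (2 ^ m).-1)%N.
    by rewrite -{2}(prednK m0) expnS mul2n -addnn -ltnS prednK ?addn_gt0 ?p0// -addn1 leq_add2l.
  by rewrite ler_ln ?posrE ?ltr0n// ?ler_nat// (leq_trans p0).
have m14 : v / 4 <= m%:R - 1 by lra.
have gv : (P1 - P2) * (v / 8) <= 5.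
  apply: le_trans gap; rewrite ler_wpM2l ?subr_ge0 ?(ltW P12)//.
  by apply: le_trans lnm; lra.
have -> : s / U = w^-1 by rewrite invf_div.
rewrite sqrtrV// -/v ler_pdivlMr; lra.
Qed.

End LongStaircases.

Theorem theorem3 (R : realType) :
  (* 1. signed and unsigned IPS, d >= 1, s <= min(cU, U/(4 sqrt d)):
        P1 - P2 = O(1 / log(d log_{1/c}(U/s))) *)
  (exists C : R, forall (unsigned : bool) (d : nat) (U c s P1 P2 : R)
     (dsp : measure_display) (T : measurableType dsp) (P : probability T R)
     (Y : Type) (hp hq : T -> 'rV[R]_d -> Y),
     (1 <= d)%N -> 0 < c < 1 -> 0 < s ->
     s <= c * U -> s <= U / (4 * Num.sqrt (d%:R)) ->
     is_ALSH P hp hq (ips_sim unsigned) (origin_ball d 1) (origin_ball d U) s (c * s) P1 P2 ->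
     (P1 - P2) * ln (d%:R * (ln (U / s) / ln c^-1)) <= C) /\
  (* 2. signed IPS, d >= 2, s <= U/(2d): P1 - P2 = O(1 / log(dU/(s(1-c)))) *)
  (exists C : R, forall (d : nat) (U c s P1 P2 : R)
     (dsp : measure_display) (T : measurableType dsp) (P : probability T R)
     (Y : Type) (hp hq : T -> 'rV[R]_d -> Y),
     (2 <= d)%N -> 0 < c < 1 -> 0 < s ->
     s <= U / (2 * d%:R) ->
     is_ALSH P hp hq (ips_sim false) (origin_ball d 1) (origin_ball d U) s (c * s) P1 P2 ->
     (P1 - P2) * ln (d%:R * U / (s * (1 - c))) <= C) /\
  (* 3. signed and unsigned IPS, d > K U^5/(c^2 s^5), s <= U/8:
        P1 - P2 = O(sqrt(s/U)) *)
  (exists K C : R, forall (unsigned : bool) (d : nat) (U c s P1 P2 : R)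
     (dsp : measure_display) (T : measurableType dsp) (P : probability T R)
     (Y : Type) (hp hq : T -> 'rV[R]_d -> Y),
     0 < c < 1 -> 0 < s ->
     K * (U ^+ 5 / (c ^+ 2 * s ^+ 5)) < d%:R -> s <= U / 8 ->
     is_ALSH P hp hq (ips_sim unsigned) (origin_ball d 1) (origin_ball d U) s (c * s) P1 P2 ->
     P1 - P2 <= C * Num.sqrt (s / U)) /\
  (* 4. No asymmetric LSH with P1 > P2 exists for an unbounded query domain. *)
  (forall (unsigned : bool) (d : nat) (c s P1 P2 : R)
     (dsp : measure_display) (T : measurableType dsp) (P : probability T R)
     (Y : Type) (hp hq : T -> 'rV[R]_d -> Y),
     (1 <= d)%N -> 0 < c < 1 -> 0 < s ->
     is_ALSH P hp hq (ips_sim unsigned) (origin_ball d 1) setT s (c * s) P1 P2 ->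
     ~ (P2 < P1)).
Proof.
split; first by exists 11 => *; apply: alsh_gap_ladder; eassumption.
split; first by exists 27 => *; apply: alsh_gap_signed; eassumption.
split; first by exists 36, 40 => *; apply: alsh_gap_high_dim; eassumption.
move=> unsigned d c s P1 P2 dsp T P Y hp hq d1 c01 s0 lsh P21.
have c0 : 0 < c by case/andP: c01.
have gap n : (P1 - P2) * ln n.+1%:R <= 5.
  (* An unbounded query domain contains a ball large enough for a geometric staircase of any
     length. *)
  pose U := s / c ^+ (2 * n).
  have lshU : is_ALSH P hp hq (ips_sim unsigned) (origin_ball d 1) (origin_ball d U)
      s (c * s) P1 P2 by move=> p q pB _; exact: lsh.
  by apply: (alsh_gap_geometric lshU) => //; rewrite /U divfK// gt_eqF ?exprn_gt0.
have P0 : 0 < P1 - P2 by rewrite subr_gt0.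
(* A staircase of length [2 ^ k.+1] has logarithm at least [k.+1 / 2 > 5 / (P1 - P2)], a
   contradiction. *)
pose k := Num.truncn (10 / (P1 - P2)).
have := gap (2 ^ k.+1).-1; rewrite prednK ?expn_gt0// natrX lnXn// -(mulr_natl (ln 2)).
have : 10 / (P1 - P2) < k.+1%:R := truncnS_gt _.
rewrite ltr_pdivrMr// => hk; have := ln2_ge_half R; nra.
Qed.
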